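(* Let $\ell,n,m\in\mathbb{N}^*=\{1,2,\dots\}$. The set $$S=\left\{(E,A,B)\in\Sigma_{\ell,n,m}\;\middle|\;\text{the system } \tfrac{\mathrm{d}}{\mathrm{d}t}(Ex)=Ax+Bu \text{ is freely initializable}\right\}$$ is generic if, and only if, $\ell\leq n+m$.
   Context: $\Sigma_{\ell,n,m}:=\mathbb{R}^{\ell\times n}\times\mathbb{R}^{\ell\times n}\times\mathbb{R}^{\ell\times m}$, identified with $\mathbb{R}^{2\ell n+\ell m}$ by listing matrix entries. A set $\mathbb{V}\subseteq\mathbb{R}^N$ is an algebraic variety if it is the set of common zeros of finitely many polynomials in $\mathbb{R}[x_1,\dots,x_N]$; it is proper if $\mathbb{V}\neq\mathbb{R}^N$. A set $S\subseteq\mathbb{R}^N$ is generic if its complement is contained in some proper algebraic variety. A mapping $(x,u):\mathbb{R}\to\mathbb{R}^n\times\mathbb{R}^m$ is a solution of $\tfrac{\mathrm{d}}{\mathrm{d}t}(Ex)=Ax+Bu$ if $x\in\mathcal{L}^1_{\mathrm{loc}}(\mathbb{R},\mathbb{R}^n)$, $u\in\mathcal{L}^1_{\mathrm{loc}}(\mathbb{R},\mathbb{R}^m)$ (locally integrable functions), $Ex:\mathbb{R}\to\mathbb{R}^\ell$ is (locally) absolutely continuous, and $\tfrac{\mathrm{d}}{\mathrm{d}t}(Ex)(t)=Ax(t)+Bu(t)$ for all $t$ outside a Lebesgue nullset. The set of all solutions is denoted $\mathfrak{B}_{[E,A,B]}$. The system $(E,A,B)$ is freely initializable if for every $x_0\in\mathbb{R}^n$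 there exists $(x,u)\in\mathfrak{B}_{[E,A,B]}$ with $x(0)=x_0$. *)

(* Defs.v *)
From HB Require Import structures.
From mathcomp Require Import all_boot all_order all_algebra.
From mathcomp Require Import all_classical all_reals all_analysis.
(* The notations of mpoly clash with those of MathComp-Analysis: below,
   [mpoly N R] is the ring {mpoly R[N]} and [meval v p] is the value p.@[v]. *)
From mathcomp Require Import -(notations) mpoly.
Set Implicit Arguments.
Unset Strict Implicit.
Unset Printing Implicit Defensive.
Import Order.TTheory GRing.Theory Num.Theory.
Import numFieldNormedType.Exports.
Local Open Scope classical_set_scope.
Local Open Scope ring_scope.

Definition algebraic_variety (R : realType) (N : nat) (V : set 'rV[R]_N) : Prop :=
  exists s : seq (mpoly N R),
    V = [set v | forall p, p \in s -> meval (v ord0) p = 0].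

Definition generic (R : realType) (N : nat) (S : set 'rV[R]_N) : Prop :=
  exists V : set 'rV[R]_N,
    [/\ algebraic_variety V, V <> [set: 'rV[R]_N] & ~` S `<=` V].

Definition Sigma (R : realType) (l n m : nat) : Type :=
  ('M[R]_(l, n) * 'M[R]_(l, n) * 'M[R]_(l, m))%type.

Definition Sigma_vec (R : realType) (l n m : nat) (s : Sigma R l n m) :
    'rV[R]_(l * n + l * n + l * m) :=
  let: (E, A, B) := s in row_mx (row_mx (mxvec E) (mxvec A)) (mxvec B).

(* The reals with the Lebesgue sigma-algebra, which is the domain of
   [completed_lebesgue_measure]; the canonical sigma-algebra on [R], used by
   [lebesgue_measure] and [locally_integrable], is only the Borel one. *)
Definition lebesgueType (R : realType) :=
  caratheodory_type (mu_ext (@wlength R idfun)).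

Definition L1loc (R : realType) (f : R -> R) : Prop :=
  measurable_fun [set: lebesgueType R] (f : lebesgueType R -> R) /\
  forall K : set R, compact K ->
    (\int[@completed_lebesgue_measure R]_(t in K) `|f t|%:E < +oo)%E.

Definition absolutely_continuous (R : realType) (a b : R) (f : R -> R) : Prop :=
  forall e : R, 0 < e -> exists2 d : R, 0 < d &
    forall (k : nat) (I : 'I_k -> R * R),
      (forall i, (I i).1 <= (I i).2 /\ `[(I i).1, (I i).2] `<=` `[a, b]) ->
      trivIset [set: 'I_k] (fun i => [set` `](I i).1, (I i).2[]) ->
      \sum_(i < k) ((I i).2 - (I i).1) < d ->
      \sum_(i < k) `|f (I i).2 - f (I i).1| < e.

Definition locally_absolutely_continuous (R : realType) (f : R -> R) : Prop :=
  forall a b : R, absolutely_continuous a b f.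

Definition is_solution (R : realType) (l n m : nat) (s : Sigma R l n m)
    (x : R -> 'cV[R]_n) (u : R -> 'cV[R]_m) : Prop :=
  let: (E, A, B) := s in
  [/\ forall j, L1loc (fun t => x t j ord0),
      forall j, L1loc (fun t => u t j ord0),
      forall i, locally_absolutely_continuous (fun t => (E *m x t) i ord0)
    & {ae @completed_lebesgue_measure R, forall t : R, forall i : 'I_l,
        is_derive t 1 (fun r : R => (E *m x r) i ord0)
          ((A *m x t + B *m u t) i ord0)}].

Definition behavior (R : realType) (l n m : nat) (s : Sigma R l n m) :
    set ((R -> 'cV[R]_n) * (R -> 'cV[R]_m)) :=
  [set xu | is_solution s xu.1 xu.2].

Definition freely_initializable (R : realType) (l n m : nat)
    (s : Sigma R l n m) : Prop :=
  forall x0 : 'cV[R]_n, exists2 xu, behavior s xu & xu.1 0 = x0.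

(* Main.v *)
(** If [l <= n + m], then generically [[E B]] has a right inverse [[K1; K2]];
    solving [x' = K1 A x], [x 0 = x0] by a power series and putting
    [u = - K2 A x] gives [E x' = A x + B u].
    If [l > n + m], then generically [[E B a]] has a left inverse, [a] being a
    column of [A].  Hence [E] has a left inverse, and there is a row [w] with
    [w E = 0], [w B = 0] and [w A <> 0].  Along a solution [w A x = 0] almost
    everywhere; as [x] is recovered from the continuous function [E x], this
    holds at time [0] too, so some initial values are excluded.  Two nonempty
    Zariski-open sets always meet, so the set is then not generic. *)
Require Import Defs.
From mathcomp Require Import all_boot all_order all_algebra.
From mathcomp Require Import all_classical all_reals all_analysis.
From mathcomp Require Import measurable_realfun.
From mathcomp Require Import -(notations) mpoly.
Set Implicit Arguments.
Unset Strict Implicit.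
Unset Printing Implicit Defensive.
Import Order.TTheory GRing.Theory Num.Theory.
Import numFieldNormedType.Exports.
Local Open Scope classical_set_scope.
Local Open Scope ring_scope.

Section Analysis.
Variable R : realType.

(** * Local integrability and absolute continuity *)

Lemma continuous_bounded_on_compact (f : R -> R) (K : set R) :
  continuous f -> compact K ->
  exists2 M, 0 < M & forall t, K t -> `|f t| <= M.
Proof.
move=> fc cK.
have /compact_bounded [N [_ fN]] : compact (f @` K).
  by apply: continuous_compact => //; exact: continuous_subspaceT.
exists (Num.max 1 (N + 1)); first by rewrite lt_max ltr01.
move=> t Kt; apply: (fN); last by exists t.
by rewrite lt_max ltrDl ltr01 orbT.
Qed.

(** Borel sets are Lebesgue measurable, and the integral over a compact set is at most a bound of
    |f| there times a finite measure. *)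
Lemma continuous_L1loc (f : R -> R) : continuous f -> L1loc f.
Proof.
move=> fc.
have mf : measurable_fun [set: lebesgueType R] (f : lebesgueType R -> R).
  move=> _ Y mY; apply: sub_caratheodory.
  exact: (continuous_measurable_fun fc measurableT mY).
split=> // K cK.
have [M M0 fM] := continuous_bounded_on_compact fc cK.
have mK : measurable (K : set (lebesgueType R)).
  by apply: sub_caratheodory; exact: compact_measurable cK.
apply: (@le_lt_trans _ _
    (M%:E * @completed_lebesgue_measure R (K : set (lebesgueType R)))%E).
  have := @integral_le_bound _ _ R (@completed_lebesgue_measure R) K
    (EFin \o f) M%:E mK.
  apply.
  - by apply/measurable_EFinP; apply: measurable_funS mf.
  - by rewrite lee_fin ltW.
  - by apply: aeW => t Kt; rewrite lee_fin; exact: fM.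
have -> : @completed_lebesgue_measure R K = @lebesgue_measure R K by [].
by apply: lte_mul_pinfty; rewrite ?lee_fin ?ltW// compact_finite_measure.
Qed.

(** By the mean value theorem, [f] varies over each interval by at most [M] times its length, where
    [M] bounds |g| on [a, b]. *)
Lemma C1_locally_absolutely_continuous (f g : R -> R) :
  (forall t : R, is_derive t 1 f (g t)) -> continuous g ->
  locally_absolutely_continuous f.
Proof.
move=> fg gc a b e e0.
have [M M0 gM] := continuous_bounded_on_compact gc (@segment_compact R a b).
exists (e / M); first exact: divr_gt0.
move=> k I Iab _ Id.
have fc : continuous f.
  by move=> t; apply/differentiable_continuous/derivable1_diffP; case: (fg t).
apply: (@le_lt_trans _ _ (M * \sum_(i < k) ((I i).2 - (I i).1))).
  rewrite mulr_sumr; apply: ler_sum => i _.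
  have [I12 Isub] := Iab i.
  have [c cI ->] := @MVT_segment R f g _ _ I12 (fun x _ => fg x)
    (continuous_subspaceT fc).
  rewrite normrM [X in _ * X]ger0_norm ?subr_ge0//.
  by rewrite ler_wpM2r ?subr_ge0//; apply/gM/Isub.
by rewrite mulrC -ltr_pdivlMr.
Qed.

Lemma locally_absolutely_continuous_continuous (f : R -> R) :
  locally_absolutely_continuous f -> continuous f.
Proof.
move=> fac t; apply/cvgrPdist_lt => e e0.
have [d d0 fd] := fac (t - 1) (t + 1) e e0.
near=> s.
have st1 : `|t - s| < 1 by near: s; apply: cvgr_dist_lt.
have std : `|t - s| < d by near: s; apply: cvgr_dist_lt.
(* A family of one interval, with the endpoints [s] and [t] put in increasing order. *)
have := fd 1%N (fun=> (Num.min s t, Num.max s t)).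
rewrite !big_ord_recl !big_ord0 !addr0 /=.
have -> : `|f (Num.max s t) - f (Num.min s t)| = `|f t - f s|.
  by case: (leP s t) => //; rewrite distrC.
have -> : Num.max s t - Num.min s t = `|t - s|.
  by case: (leP s t) => h;
    [rewrite ger0_norm ?subr_ge0|rewrite ltr0_norm ?subr_lt0// opprB].
apply=> //.
- move=> _; split; first by rewrite ge_min le_max lexx.
  have := st1; rewrite ltr_distlC => /andP[st2 st3].
  apply: subset_itvScc; rewrite bnd_simp ?le_min ?ge_max (ltW st2, ltW st3)/=.
    by rewrite lerBlDr lerDl.
  by rewrite lerDl.
- by move=> i j _ _ _; rewrite !ord1.
Unshelve. all: by end_near.
Qed.

Lemma is_derive_mulmx (l n : nat) (E : 'M[R]_(l, n)) (x : R -> 'cV[R]_n)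
    (dx : 'cV[R]_n) (t : R) :
  (forall j, is_derive t 1 (fun r => x r j ord0) (dx j ord0)) ->
  forall i, is_derive t 1 (fun r => (E *m x r) i ord0) ((E *m dx) i ord0).
Proof.
move=> xdx i; rewrite mxE.
rewrite (_ : (fun r => _) = \sum_(j < n) (E i j \*: (fun r => x r j ord0))).
  by apply: is_derive_sum => j; exact: is_deriveZ.
by apply/funext => r; rewrite mxE fct_sumE.
Qed.

(** * The linear equation x' = M x, solved by power series *)

Definition flow_coef n (M : 'M[R]_n) (x0 : 'cV[R]_n) (i : 'I_n) : R^nat :=
  fun k => iter k (mulmx M) x0 i ord0 / k`!%:R.

(** The matrix exponential exp(tM) applied to [x0]. *)
Definition flow n (M : 'M[R]_n) (x0 : 'cV[R]_n) (t : R) : 'cV[R]_n :=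
  \col_i limn (pseries (flow_coef M x0 i) t).

Lemma is_cvg_flow n (M : 'M[R]_n) (x0 : 'cV[R]_n) i (t : R) :
  cvgn (pseries (flow_coef M x0 i) t).
Proof.
(* Each entry of M^k x0 is at most b^k c in absolute value, so [c] times the exponential series at
   b|t| dominates. *)
pose b := \sum_i \sum_j `|M i j|; pose c := \sum_i `|x0 i ord0|.
have b0 : 0 <= b by do 2![apply: sumr_ge0 => ? _].
have c0 : 0 <= c by apply: sumr_ge0 => ? _.
have Mb i' : \sum_j `|M i' j| <= b.
  by rewrite /b [leRHS](bigD1 i')//= lerDl; do 2![apply: sumr_ge0 => ? _].
have itb k : forall i, `|iter k (mulmx M) x0 i ord0| <= b ^+ k * c.
  elim: k => [|k IH] i'.
    by rewrite expr0 mul1r /c (bigD1 i')//= lerDl; apply: sumr_ge0 => ? _.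
  rewrite iterS mxE (le_trans (ler_norm_sum _ _ _))//.
  apply: (@le_trans _ _ (\sum_j `|M i' j| * (b ^+ k * c))).
    by apply: ler_sum => j _; rewrite normrM ler_wpM2l.
  by rewrite -mulr_suml exprS -mulrA ler_wpM2r// mulr_ge0// exprn_ge0.
apply: normed_cvg.
apply: (@series_le_cvg _ _ (fun k => c * exp_coeff (b * `|t|) k)).
- by move=> k /=.
- move=> k; rewrite mulr_ge0// /exp_coeff /= divr_ge0// exprn_ge0//.
  by rewrite mulr_ge0.
- move=> k; rewrite /flow_coef /exp_coeff /= !normrM normfV normrX.
  rewrite (ger0_norm (ler0n _ _)) exprMn mulrAC !mulrA.
  by rewrite ler_wpM2r ?invr_ge0 ?ler0n// ler_wpM2r ?exprn_ge0// [leRHS]mulrC.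
- apply: is_cvg_seriesZ; exact: is_cvg_series_exp_coeff.
Qed.

(** Termwise differentiation cancels one factor of the factorial and shifts the iterates by one, so
    [x0] becomes [M *m x0]. *)
Lemma pseries_diffs_flow_coef n (M : 'M[R]_n) (x0 : 'cV[R]_n) i :
  pseries_diffs (flow_coef M x0 i) = flow_coef M (M *m x0) i.
Proof.
apply/funext => k; rewrite /pseries_diffs /flow_coef iterSr factS natrM.
by rewrite invfM mulrCA mulVKf.
Qed.

Lemma mulmx_flow n (M : 'M[R]_n) (x0 : 'cV[R]_n) (t : R) :
  M *m flow M x0 t = flow M (M *m x0) t.
Proof.
apply/colP => i; rewrite !mxE; apply/esym/cvg_lim => //.
rewrite (_ : pseries _ _ =
    (fun k => \sum_j M i j * pseries (flow_coef M x0 j) t k)).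
  apply: cvg_big => [|j _]; first exact: add_continuous.
  by rewrite mxE; apply: cvgM; [exact: cvg_cst|exact: is_cvg_flow].
apply/funext => k; rewrite /pseries /series /=.
under [RHS]eq_bigr do rewrite mulr_sumr.
rewrite exchange_big; apply: eq_bigr => p _.
rewrite /flow_coef -iterSr iterS mxE !mulr_suml.
by apply: eq_bigr => j _; rewrite !mulrA.
Qed.

Lemma is_derive_flow n (M : 'M[R]_n) (x0 : 'cV[R]_n) (t : R) i :
  is_derive t 1 (fun r => flow M x0 r i ord0) ((M *m flow M x0 t) i ord0).
Proof.
rewrite mulmx_flow mxE -pseries_diffs_flow_coef.
rewrite (_ : (fun r => _) = (fun r => limn (pseries (flow_coef M x0 i) r))).
  (* Any radius above |t| would do, as the series converges everywhere. *)
  apply: (@pseries_snd_diffs _ _ (`|t| + 1));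
    rewrite ?pseries_diffs_flow_coef; try exact: is_cvg_flow.
  by rewrite [ltRHS]ger0_norm ?addr_ge0// ltrDl.
by apply/funext => r; rewrite mxE.
Qed.

Lemma flow0 n (M : 'M[R]_n) (x0 : 'cV[R]_n) : flow M x0 0 = x0.
Proof.
apply/colP => i; rewrite mxE; apply/cvg_lim => //.
apply: cvg_near_cst; near=> k.
(* Only a nonempty partial sum contains the constant term [x0]; the other terms vanish at 0. *)
rewrite /pseries /series /= -[k]prednK; last by near: k; exists 1%N.
rewrite big_nat_recl//= big1 ?addr0; last first.
  by move=> j _; rewrite exprS mul0r mulr0.
by rewrite /flow_coef expr0 mulr1 fact0 divr1.
Unshelve. all: by end_near.
Qed.

(** Under the state feedback u = F x, the right-hand side A x + B u equals E M x, the derivative of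
    E x. *)
Lemma flow_is_solution (l n m : nat) (E A : 'M[R]_(l, n)) (B : 'M[R]_(l, m))
    (M : 'M[R]_n) (F : 'M[R]_(m, n)) (x0 : 'cV[R]_n) :
  E *m M = A + B *m F ->
  is_solution (E, A, B) (flow M x0) (fun t => F *m flow M x0 t).
Proof.
move=> EM.
have dflow t := is_derive_mulmx E (is_derive_flow M x0 t).
have cflow k (G : 'M[R]_(k, n)) i :
    continuous (fun t => (G *m flow M x0 t) i ord0).
  move=> t; apply/differentiable_continuous/derivable1_diffP.
  by have [] := is_derive_mulmx G (is_derive_flow M x0 t) i.
split.
- move=> j; apply: continuous_L1loc.
  by have := cflow _ 1%:M j; under eq_fun do rewrite mul1mx.
- by move=> j; exact: continuous_L1loc.
- move=> i; apply: (@C1_locally_absolutely_continuous _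
      (fun t => (E *m M *m flow M x0 t) i ord0)); last exact: cflow.
  by move=> t; have := dflow t i; rewrite mulmxA.
- apply: aeW => t i; have := dflow t i.
  by rewrite mulmxA EM mulmxDl mulmxA.
Qed.

(** * Obstruction to free initialization *)

Lemma ae_continuous_eq0 (f : R -> R) :
  continuous f -> {ae @completed_lebesgue_measure R, forall t : R, f t = 0} ->
  forall t, f t = 0.
Proof.
move=> fc f0 t; apply/eqP/negPn/negP => ft0.
have nbhs0 : nbhs (f t) [set y : R | y != 0].
  by apply: open_nbhs_nbhs; split; [exact: open_neq|].
move: (fc t _ nbhs0) => /nbhs_ballP[e e0 be].
(* A ball on which [f] has no zero would be a null set, yet its measure is positive. *)
have mball : measurable (ball t e : set (lebesgueType R)).
  by apply: sub_caratheodory; exact: (measurable_ball t e).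
have : @lebesgue_measure R (ball t e) = 0.
  apply: (@measure_negligible _ (lebesgueType R) R
    (@completed_lebesgue_measure R) (ball t e) mball).
  apply: negligibleS f0 => s ts /=.
  exact/eqP/be.
rewrite lebesgue_measure_ball ?ltW// => /eqP.
by rewrite eqe mulrn_eq0/= gt_eqF.
Qed.

Lemma freely_initializable_left_kernel (l n m : nat) (E A : 'M[R]_(l, n))
    (B : 'M[R]_(l, m)) (K : 'M[R]_(n, l)) (w : 'rV[R]_l) :
  K *m E = 1%:M -> w *m E = 0 -> w *m B = 0 ->
  freely_initializable (E, A, B) -> w *m A = 0.
Proof.
move=> KE wE wB free; apply/rowP => j.
(* Starting at the [j]-th basis vector makes w A x(0) the [j]-th entry of w A. *)
have [[x u] /= [_ _ Exac Exd] x0] := free (delta_mx j ord0).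
suff : forall t, (w *m A *m x t) ord0 ord0 = 0.
  by move=> /(_ 0); rewrite x0 -colE => wAj; rewrite [RHS]mxE -wAj [RHS]mxE.
apply: ae_continuous_eq0.
  (* From K E = 1 one gets w A x = (w A K)(E x), which is continuous because E x is. *)
  rewrite (_ : (fun t => _) =
      fun t => \sum_i (w *m A *m K) ord0 i * (E *m x t) i ord0).
    move=> t; apply: cvg_big => [|i _]; first exact: add_continuous.
    by apply: cvgM; [exact: cvg_cst|
      exact: locally_absolutely_continuous_continuous].
  apply/funext => t.
  by rewrite -[x t in LHS]mul1mx -KE -mulmxA !mulmxA -mulmxA mxE.
(* Where the equation holds, 0 = (w E x)' = w (A x + B u) = w A x. *)
apply: negligibleS Exd; apply: subsetC => t /= Exd.
have := is_derive_mulmx w Exd ord0.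
under eq_fun do rewrite mulmxA wE mul0mx mxE.
rewrite mulmxDr !mulmxA wB mul0mx addr0 => /(@derive_val _ _ _ _ _ _ _) <-.
exact: derive_cst.
Qed.

End Analysis.

(** * Nonvanishing polynomials and generic sets *)

Lemma poly_nonroot (R : numDomainType) (p : {poly R}) :
  p != 0 -> exists t, p.[t] != 0.
Proof.
move=> p0; apply: contrapT => nt.
(* The numbers 0, ..., [size p] - 1 are distinct and too many to be all roots. *)
have := @max_poly_roots _ p [seq i%:R | i <- iota 0 (size p)] p0.
rewrite size_map size_iota ltnn => /(_ _ _)/wrap[]//.
- apply/allP => t _; apply/negPn/negP => pt; apply: nt; exists t.
  exact: pt.
- by rewrite map_inj_uniq ?iota_uniq// => i j /eqP; rewrite eqr_nat => /eqP.
Qed.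

Lemma horner_mmap (R : comNzRingType) (N : nat) (h : 'I_N -> {poly R})
    (p : mpoly N R) (t : R) :
  (mmap polyC h p).[t] = meval (fun i => (h i).[t]) p.
Proof.
rewrite mevalE /mmap horner_sum; apply: eq_bigr => mo _.
rewrite hornerM hornerC /mmap1 horner_prod; congr (_ * _).
by apply: eq_bigr => i _; rewrite horner_exp.
Qed.

(* Restrict [p] and [q] to the line through [v] and [w]. *)
Lemma meval_common_nonzero (R : numDomainType) (N : nat) (p q : mpoly N R)
    (v w : 'rV[R]_N) :
  meval (v ord0) p != 0 -> meval (w ord0) q != 0 ->
  exists z : 'rV[R]_N, meval (z ord0) p != 0 /\ meval (z ord0) q != 0.
Proof.
move=> pv qw.
pose h i : {poly R} := (v ord0 i)%:P + (w ord0 i - v ord0 i) *: 'X.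
have hE t : (fun i => (h i).[t]) = (v + t *: (w - v)) ord0.
  by apply/funext => i; rewrite !hornerE !mxE mulrC.
have pn : mmap polyC h p != 0.
  apply: contraNneq pv => p0; have := horner_mmap h p 0.
  by rewrite p0 horner0 hE scale0r addr0 => <-.
have qn : mmap polyC h q != 0.
  apply: contraNneq qw => q0; have := horner_mmap h q 1.
  by rewrite q0 horner0 hE scale1r addrC subrK => <-.
(* The restrictions are nonzero polynomials, by their values at 0 and 1; hence so is their
   product. *)
have [t] := poly_nonroot (mulf_neq0 pn qn).
rewrite hornerM !horner_mmap hE mulf_eq0 negb_or => /andP[? ?].
by exists (v + t *: (w - v)).
Qed.

Lemma generic_of_poly (R : realType) (N : nat) (S : set 'rV[R]_N)
    (p : mpoly N R) (v : 'rV[R]_N) :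
  meval (v ord0) p != 0 ->
  (forall z : 'rV[R]_N, meval (z ord0) p != 0 -> S z) ->
  generic S.
Proof.
move=> pv pS.
exists [set z : 'rV[R]_N | forall q, q \in [:: p] -> meval (z ord0) q = 0].
split; first by exists [:: p].
- move=> /seteqP[_ /(_ v I)] /(_ p) /=; rewrite inE eqxx => /(_ isT) pv0.
  by rewrite pv0 eqxx in pv.
- move=> z Sz q; rewrite inE => /eqP ->; apply/eqP/negPn/negP => pz.
  exact/Sz/pS.
Qed.

(** One equation [p] of a proper variety is nonzero somewhere; a point where [p] and [q] are both
    nonzero lies outside [S] and outside the variety. *)
Lemma nongeneric_of_poly (R : realType) (N : nat) (S : set 'rV[R]_N)
    (q : mpoly N R) (w : 'rV[R]_N) :
  meval (w ord0) q != 0 ->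
  (forall z : 'rV[R]_N, meval (z ord0) q != 0 -> ~ S z) ->
  ~ generic S.
Proof.
move=> qw qS [V [[s ->] Vproper SV]].
have [v /= /existsNP[p /not_implyP[ps /eqP pv]]] :
    exists v : 'rV[R]_N, ~ forall p, p \in s -> meval (v ord0) p = 0.
  apply/existsNP => Vall; apply: Vproper; apply/seteqP.
  by split=> z // _; exact: Vall.
have [z [pz qz]] := meval_common_nonzero pv qw.
by have := SV z (qS z qz) p ps; apply/eqP.
Qed.

(** * Matrix entries as coordinates *)

Section Coordinates.
Variables l n m : nat.

(** The entry type [T] is left free so that the same blocks can be read off real vectors and off the
    vector of indeterminates. *)
Definition E_of T (v : 'rV[T]_(l * n + l * n + l * m)) : 'M[T]_(l, n) :=
  vec_mx (lsubmx (lsubmx v)).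
Definition A_of T (v : 'rV[T]_(l * n + l * n + l * m)) : 'M[T]_(l, n) :=
  vec_mx (rsubmx (lsubmx v)).
Definition B_of T (v : 'rV[T]_(l * n + l * n + l * m)) : 'M[T]_(l, m) :=
  vec_mx (rsubmx v).

Variable R : realType.

Lemma Sigma_vec_of (v : 'rV[R]_(l * n + l * n + l * m)) :
  Sigma_vec (E_of v, A_of v, B_of v) = v.
Proof. by rewrite /Sigma_vec !vec_mxK !hsubmxK. Qed.

Lemma Sigma_vecK (E A : 'M[R]_(l, n)) (B : 'M[R]_(l, m)) :
  let v := Sigma_vec (E, A, B) in [/\ E_of v = E, A_of v = A & B_of v = B].
Proof.
by rewrite /Sigma_vec /E_of /A_of /B_of !(row_mxKl, row_mxKr) !mxvecK.
Qed.

(* The vector of indeterminates: a minor of the matrices it encodes is a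
   polynomial in the matrix entries, specialised by [meval]. *)
Definition generic_point N : 'rV[mpoly N R]_N := \row_i mpolyX R (mnm1 i).

Lemma map_generic_point N (v : 'rV[R]_N) :
  map_mx (meval (v ord0)) (generic_point N) = v.
Proof. by apply/rowP => i; rewrite !mxE mevalXU. Qed.

Notation X := (generic_point (l * n + l * n + l * m)).

Lemma map_E_of (v : 'rV[R]_(l * n + l * n + l * m)) :
  map_mx (meval (v ord0)) (E_of X) = E_of v.
Proof. by rewrite map_vec_mx !map_lsubmx map_generic_point. Qed.

Lemma map_A_of (v : 'rV[R]_(l * n + l * n + l * m)) :
  map_mx (meval (v ord0)) (A_of X) = A_of v.
Proof. by rewrite map_vec_mx map_rsubmx map_lsubmx map_generic_point. Qed.

Lemma map_B_of (v : 'rV[R]_(l * n + l * n + l * m)) :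
  map_mx (meval (v ord0)) (B_of X) = B_of v.
Proof. by rewrite map_vec_mx map_rsubmx map_generic_point. Qed.

End Coordinates.

(** * One-sided inverses and free initializability *)

Lemma right_inverse_of_minor (F : fieldType) (l k : nat) (f : 'I_l -> 'I_k)
    (M : 'M[F]_(l, k)) :
  \det (colsub f M) != 0 -> exists K, M *m K = 1%:M.
Proof.
(* Multiplying [M] by [colsub f 1%:M] extracts the invertible square block. *)
move=> Mf; exists (colsub f 1%:M *m invmx (colsub f M)).
by rewrite mulmxA mulmx_colsub mulmx1 mulmxV// unitmxE unitfE.
Qed.

Lemma left_inverse_of_minor (F : fieldType) (l k : nat) (f : 'I_k -> 'I_l)
    (M : 'M[F]_(l, k)) :
  \det (rowsub f M) != 0 -> exists K, K *m M = 1%:M.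
Proof.
move=> Mf; exists (invmx (rowsub f M) *m rowsub f 1%:M).
by rewrite -mulmxA mul_rowsub_mx mul1mx mulVmx// unitmxE unitfE.
Qed.

Lemma colsub_pid_mx (F : fieldType) (l k : nat) (lk : (l <= k)%N) :
  colsub (widen_ord lk) (pid_mx l : 'M[F]_(l, k)) = 1%:M.
Proof. by apply/matrixP => i j; rewrite !mxE ltn_ord andbT. Qed.

Lemma rowsub_pid_mx (F : fieldType) (l k : nat) (kl : (k <= l)%N) :
  rowsub (widen_ord kl) (pid_mx k : 'M[F]_(l, k)) = 1%:M.
Proof. by apply/matrixP => i j; rewrite !mxE /= ltn_ord andbT. Qed.

(** With K1, K2 the blocks of [K], E K1 + B K2 = 1 gives E (K1 A) = A + B (- K2 A). *)
Lemma freely_initializable_right_inverse (R : realType) (l n m : nat)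
    (E A : 'M[R]_(l, n)) (B : 'M[R]_(l, m)) (K : 'M[R]_(n + m, l)) :
  row_mx E B *m K = 1%:M -> freely_initializable (E, A, B).
Proof.
rewrite -[K]vsubmxK mul_row_col => EBK x0.
exists (flow (usubmx K *m A) x0,
  fun t => - (dsubmx K *m A) *m flow (usubmx K *m A) x0 t); last exact: flow0.
apply: flow_is_solution.
by rewrite mulmxN !mulmxA -[A in A - _]mul1mx -EBK mulmxDl addrK.
Qed.

(** The first [n] rows of [K] form a left inverse of [E]; the last row w satisfies w E = 0 and w B =
    0, but maps column [j] of [A] to 1. *)
Lemma not_freely_initializable_left_inverse (R : realType) (l n m : nat)
    (E A : 'M[R]_(l, n)) (B : 'M[R]_(l, m)) (j : 'I_n)
    (K : 'M[R]_(n + m + 1, l)) :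
  K *m row_mx (row_mx E B) (col j A) = 1%:M -> ~ freely_initializable (E, A, B).
Proof.
rewrite -[K]vsubmxK mul_col_row scalar_mx_block.
move=> /eq_block_mx[KEB _ wEB wA] free.
have [wE wB] : dsubmx K *m E = 0 /\ dsubmx K *m B = 0.
  by apply/eq_row_mx; rewrite -mul_mx_row wEB row_mx0.
have KE : usubmx (usubmx K) *m E = 1%:M.
  move: KEB; rewrite -[usubmx K]vsubmxK mul_col_row scalar_mx_block.
  by rewrite !col_mxKu => /eq_block_mx[].
move: wA; rewrite colE mulmxA.
rewrite (freely_initializable_left_kernel KE wE wB free) mul0mx.
by move=> /matrixP/(_ ord0 ord0)/eqP; rewrite !mxE eq_sym oner_eq0.
Qed.

Theorem proposition5p5 (R : realType) (l n m : nat)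
    (l_gt0 : (0 < l)%N) (n_gt0 : (0 < n)%N) (m_gt0 : (0 < m)%N) :
  generic (@Sigma_vec R l n m @` [set s | freely_initializable s]) <->
  (l <= n + m)%N.
Proof.
split=> [|lnm].
- apply: contraPT; rewrite -ltnNge -addn1 => nml.
  (* The first n + m + 1 rows of [E B a], with a the first column of [A]. *)
  pose minor T (v : 'rV[T]_(l * n + l * n + l * m)) : 'M[T]_(n + m + 1) :=
    rowsub (widen_ord nml)
      (row_mx (row_mx (E_of v) (B_of v)) (col (Ordinal n_gt0) (A_of v))).
  have mE (v : 'rV[R]_(l * n + l * n + l * m)) :
      meval (v ord0) (\det (minor _ (generic_point R _))) = \det (minor _ v).
    rewrite -det_map_mx /minor map_mxsub !map_row_mx map_col.
    by rewrite map_E_of map_A_of map_B_of.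
  (* Witness: [E B a] = [P], every column of [A] being the last column of [P]; the minor is then
     1. *)
  pose P : 'M[R]_(l, n + m + 1) := pid_mx (n + m + 1).
  apply: (@nongeneric_of_poly _ _ _ (\det (minor _ (generic_point R _)))
    (Sigma_vec (lsubmx (lsubmx P), \matrix_(i, j) P i (rshift _ ord0),
                rsubmx (lsubmx P)))).
    rewrite mE /minor; have [-> -> ->] := Sigma_vecK (lsubmx (lsubmx P))
      (\matrix_(i, j) P i (rshift _ ord0)) (rsubmx (lsubmx P)).
    have -> : col (Ordinal n_gt0) (\matrix_(i, j) P i (rshift _ ord0)) = rsubmx P.
      by apply/matrixP => i j; rewrite !mxE (ord1 j).
    by rewrite !hsubmxK rowsub_pid_mx det1 oner_neq0.
  move=> z; rewrite mE => /left_inverse_of_minor[K KM] [[[E A] B] /= free zE].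
  apply: not_freely_initializable_left_inverse KM _.
  by rewrite -zE; have [-> -> ->] := Sigma_vecK E A B.
- pose minor T (v : 'rV[T]_(l * n + l * n + l * m)) : 'M[T]_l :=
    colsub (widen_ord lnm) (row_mx (E_of v) (B_of v)).
  have mE (v : 'rV[R]_(l * n + l * n + l * m)) :
      meval (v ord0) (\det (minor _ (generic_point R _))) = \det (minor _ v).
    by rewrite -det_map_mx /minor map_mxsub map_row_mx map_E_of map_B_of.
  (* Witness: [E B] = [P] and A = 0, whose minor is 1. *)
  pose P : 'M[R]_(l, n + m) := pid_mx l.
  apply: (@generic_of_poly _ _ _ (\det (minor _ (generic_point R _)))
    (Sigma_vec (lsubmx P, 0, rsubmx P))).
    rewrite mE /minor; have [-> _ ->] := Sigma_vecK (lsubmx P) 0 (rsubmx P).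
    by rewrite hsubmxK colsub_pid_mx det1 oner_neq0.
  move=> z; rewrite mE => /right_inverse_of_minor[K KM].
  exists (E_of z, A_of z, B_of z); last exact: Sigma_vec_of.
  exact: freely_initializable_right_inverse KM.
Qed.
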